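(* Fix an imprecise probabilities tree with finite state space $\mathscr{X}$, and let $\overline{\mathrm{E}}_{\mathrm V}$ be the corresponding game-theoretic upper expectation. For any $f\colon\Omega\to\overline{\mathbb{R}}$ and any situation $x_{1:n}\in\mathscr{X}^{\ast}$ (of any length $n\in\mathbb{N}_0$), we have that \[\overline{\mathrm{E}}_{\mathrm V}(f\vert x_{1:n})=\overline{\mathrm{E}}_{\mathrm V}\Big(\overline{\mathrm{E}}_{\mathrm V}(f\vert x_{1:n}X_{n+1})\,\Big\vert\, x_{1:n}\Big),\] where $\overline{\mathrm{E}}_{\mathrm V}(f\vert x_{1:n}X_{n+1})$ denotes the variable on $\Omega$ given by $\omega\mapsto\overline{\mathrm{E}}_{\mathrm V}(f\vert x_{1:n}\omega_{n+1})$, with $\omega_{n+1}$ the $(n+1)$-th state value of $\omega$.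
   Context: Notation: $\mathbb{N}=\{1,2,\dots\}$, $\mathbb{N}_0=\mathbb{N}\cup\{0\}$, $\overline{\mathbb{R}}=\mathbb{R}\cup\{-\infty,+\infty\}$, with conventions $+\infty-\infty=-\infty+\infty=+\infty$, $0\cdot(\pm\infty)=0$, $\inf\emptyset=+\infty$. For a non-empty set $\mathscr{Y}$, $\overline{\mathscr{L}}(\mathscr{Y})$ is the set of all maps $\mathscr{Y}\to\overline{\mathbb{R}}$ and $\overline{\mathscr{L}}_b(\mathscr{Y})$ the subset of those bounded below by a real constant. Limits and inequalities of functions are pointwise. Local models: $\mathscr{X}$ is a finite non-empty set. $\mathscr{X}^{\ast}=\bigcup_{n\in\mathbb{N}_0}\mathscr{X}^n$ is the set of situations (finite strings, including the empty string $\Box$). An imprecise probabilities tree assigns to each $s\in\mathscr{X}^{\ast}$ a map $\overline{\mathrm{Q}}_s\colon\overline{\mathscr{L}}(\mathscr{X})\to\overline{\mathbb{R}}$ that is an upper expectation, i.e. satisfies: (E1) $\overline{\mathrm{Q}}_s(c)=c$ for all $c\in\mathbb{R}$; (E2) $\overline{\mathrm{Q}}_s(f+g)\le\overline{\mathrm{Q}}_s(f)+\overline{\mathrm{Q}}_s(g)$ for all $f,g\in\overline{\mathscr{L}}_b(\mathscr{X})$; (E3) $\overline{\mathrm{Q}}_s(\lambda f)=\lambda\overline{\mathrm{Q}}_s(f)$ for all real $\lambda>0$ and $f\in\overline{\mathscr{L}}_b(\mathscr{X})$; (E4) $f\le g\Rightarrow\overline{\mathrm{Q}}_s(f)\le\overline{\mathrm{Q}}_s(g)$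 for all $f,g\in\overline{\mathscr{L}}_b(\mathscr{X})$; (E5) $\lim_n\overline{\mathrm{Q}}_s(f_n)=\overline{\mathrm{Q}}_s(\lim_n f_n)$ for every non-decreasing sequence $\{f_n\}_{n\in\mathbb{N}_0}$ of non-negative variables in $\overline{\mathscr{L}}_b(\mathscr{X})$. Global model: $\Omega=\mathscr{X}^{\mathbb{N}}$ is the set of paths; for $\omega\in\Omega$, $\omega^n\in\mathscr{X}^n$ is the string of its first $n$ values; $\Gamma(x_{1:n})=\{\omega\in\Omega:\omega^n=x_{1:n}\}$. For $g,h\colon\Omega\to\overline{\mathbb{R}}$, $g\ge_s h$ means $g(\omega)\ge h(\omega)$ for all $\omega\in\Gamma(s)$. A supermartingale is a map $\mathscr{M}\colon\mathscr{X}^{\ast}\to\overline{\mathbb{R}}$ with $\overline{\mathrm{Q}}_s(\mathscr{M}(s\,\cdot))\le\mathscr{M}(s)$ for all $s\in\mathscr{X}^{\ast}$, where $\mathscr{M}(s\,\cdot)\in\overline{\mathscr{L}}(\mathscr{X})$ is $x\mapsto\mathscr{M}(sx)$. $\overline{\mathbb{M}}_{\mathrm b}$ is the set of supermartingales bounded below by a real constant, and $\liminf\mathscr{M}(\omega)=\liminf_{n\to+\infty}\mathscr{M}(\omega^n)$. The game-theoretic upper expectation is, for all $f\colon\Omega\to\overline{\mathbb{R}}$ and $s\in\mathscr{X}^{\ast}$, \[\overline{\mathrm{E}}_{\mathrm V}(f\vert s)=\inf\{\mathscr{M}(s):\mathscr{M}\in\overline{\mathbb{M}}_{\mathrm b},\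 \liminf\mathscr{M}\ge_s f\}.\] *)

(* Defs.v *)
From mathcomp Require Import all_boot all_order all_algebra.
From mathcomp Require Import all_classical all_reals.
From mathcomp Require Import ereal topology normedtype sequences.

Set Implicit Arguments.
Unset Strict Implicit.
Unset Printing Implicit Defensive.

Import Order.TTheory GRing.Theory Num.Theory.
Import numFieldNormedType.Exports.

Local Open Scope classical_set_scope.
Local Open Scope ring_scope.
Local Open Scope ereal_scope.

Definition bounded_below (R : realType) (Y : Type) (f : Y -> \bar R) : Prop :=
  exists c : R, forall y, c%:E <= f y.

(* The sums in [ue_subadditive] are the dual additions, for which
   +oo + -oo = -oo + +oo = +oo.  Nothing is assumed about the values of [Q] on
   maps that are not bounded below. *)
Record upper_expectation (R : realType) (X : Type)
    (Q : (X -> \bar R) -> \bar R) : Prop := UpperExpectation {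
  ue_cst : forall c : R, Q (fun=> c%:E) = c%:E ;
  ue_subadditive : forall f g : X -> \bar R,
    bounded_below f -> bounded_below g ->
    Q (fun x => (f x + g x)%dE) <= (Q f + Q g)%dE ;
  ue_homogeneous : forall (l : R) (f : X -> \bar R),
    (0 < l)%R -> bounded_below f ->
    Q (fun x => l%:E * f x) = l%:E * Q f ;
  ue_monotone : forall f g : X -> \bar R,
    bounded_below f -> bounded_below g ->
    (forall x, f x <= g x) -> Q f <= Q g ;
  ue_continuous : forall f_ : nat -> X -> \bar R,
    (forall n, bounded_below (f_ n)) ->
    (forall n x, 0 <= f_ n x) ->
    (forall x, nondecreasing_seq (fun n => f_ n x)) ->
    Q (f_ n) @[n --> \oo] --> Q (fun x => limn (fun n => f_ n x))
}.

(* Situations are finite sequences.  A path is a map [w : nat -> X] indexed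
   from 0: [w k] is its (k+1)-th state value, and [mkseq w n] is the string of
   its first n state values. *)
Definition cylinder (X : Type) (s : seq X) : set (nat -> X) :=
  [set w | mkseq w (size s) = s].

Definition supermartingale (R : realType) (X : Type)
    (Q : seq X -> (X -> \bar R) -> \bar R) (M : seq X -> \bar R) : Prop :=
  forall s, Q s (fun x => M (rcons s x)) <= M s.

Definition path_liminf (R : realType) (X : Type) (M : seq X -> \bar R)
    (w : nat -> X) : \bar R :=
  limn_einf (fun n => M (mkseq w n)).

Definition game_upper_expectation (R : realType) (X : Type)
    (Q : seq X -> (X -> \bar R) -> \bar R)
    (f : (nat -> X) -> \bar R) (s : seq X) : \bar R :=
  ereal_inf [set M s | M in
    [set M : seq X -> \bar R |
      [/\ supermartingale Q M,
          bounded_below M &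
          forall w, cylinder s w -> f w <= path_liminf M w]]].

(* Main.v *)
Require Import Defs.
From mathcomp Require Import all_boot all_order all_algebra.
From mathcomp Require Import all_classical all_reals.
From mathcomp Require Import ereal topology normedtype sequences.

(** A supermartingale may be given the value +oo at every situation that does
    not extend [s], and on the subtrees above the children of [s] it may be
    replaced by arbitrary supermartingales, as long as the local inequality at
    [s] survives.  For [>=], paste the constants [M (rcons s x)] above the
    children of [s].  For [<=], a supermartingale [M] whose limit inferior
    dominates a constant [c] on the cylinder of [rcons s x] satisfies
    [c <= M (rcons s x)], because [M] does not increase along some path; hence
    [M (rcons s x)] dominates the conditional upper expectation at [rcons s x],
    and near-optimal supermartingales for [f] can be pasted above the
    children. *)

Set Implicit Arguments.
Unset Strict Implicit.
Unset Printing Implicit Defensive.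

Import Order.TTheory GRing.Theory Num.Theory.
Import numFieldNormedType.Exports.

Local Open Scope classical_set_scope.
Local Open Scope ring_scope.
Local Open Scope ereal_scope.

Lemma le_limn_einf_near (R : realType) (u v : (\bar R)^nat) (N : nat) :
  (forall n, (N <= n)%N -> u n <= v n) -> limn_einf u <= limn_einf v.
Proof.
move=> uv; rewrite !limn_einf_lim; apply: lee_lim; do ?exact: is_cvg_einfs.
exists N => // n /= Nn; apply: le_ereal_inf_tmp => _ [m /= nm <-].
by apply: ge_ereal_inf; exists (u m); [exists m|exact/uv/(leq_trans Nn)].
Qed.

Lemma limn_einf_cst (R : realType) (c : \bar R) : limn_einf (fun=> c) = c.
Proof. by have [] := cvg_limn_einf_sup (@cvg_cst _ c nat \oo _). Qed.

Lemma bounded_below_cst (R : realType) (Y : Type) (c : \bar R) :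
  c != -oo -> bounded_below (fun _ : Y => c).
Proof.
by case: c => [c||] // _; [exists c|exists 0%R] => // y; rewrite leey.
Qed.

Lemma bounded_below_neqNy (R : realType) (Y : Type) (f : Y -> \bar R) (y : Y) :
  bounded_below f -> f y != -oo.
Proof. by case=> c /(_ y) cf; rewrite gt_eqF// (lt_le_trans _ cf)// ltNyr. Qed.

(** Finiteness of [X] gives a least bound; the seed [0%R] can only lower it. This keeps a process
    pasted from one piece per child bounded below. *)
Lemma finite_uniform_bounded_below (R : realType) (X : finType) (Y : Type)
    (g : X -> Y -> \bar R) :
  (forall x, bounded_below (g x)) -> exists c : R, forall x y, c%:E <= g x y.
Proof.
move=> /choice[c cg]; exists (\big[Order.min/0%R]_x c x) => x y.
by apply: le_trans (cg x y); rewrite lee_fin bigmin_le_cond.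
Qed.

Section local_model.
Context {R : realType} {X : Type} {Q : (X -> \bar R) -> \bar R}.
Hypothesis hQ : upper_expectation Q.

Lemma ue_ecst (c : \bar R) : c != -oo -> Q (fun=> c) = c.
Proof.
case: c => [c||] // _; first exact: ue_cst hQ c.
(* Case [+oo]: by monotonicity the value is at least that of every positive real constant. *)
apply/eqyP => r r0; rewrite -[leLHS](ue_cst hQ).
by apply: (ue_monotone hQ) => [||x]; do ?exact: bounded_below_cst; rewrite leey.
Qed.

Lemma ue_shift_le (f : X -> \bar R) (e : R) :
  bounded_below f -> Q (fun x => f x + e%:E) <= Q f + e%:E.
Proof.
(* Dual and ordinary addition agree when one summand is real. *)
have dD (x : \bar R) : (x + e%:E)%dE = x + e%:E by case: x.
move=> bf; have := ue_subadditive hQ bf (@bounded_below_cst R X e%:E isT).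
by rewrite (ue_cst hQ) dD; under eq_fun do rewrite dD.
Qed.

End local_model.

Section supermartingales.
Context {R : realType} {X : finType} {Q : seq X -> (X -> \bar R) -> \bar R}.
Hypothesis hQ : forall s, upper_expectation (Q s).

Lemma supermartingale_cst (c : \bar R) : c != -oo -> supermartingale Q (fun=> c).
Proof. by move=> cNy s; rewrite (ue_ecst (hQ s)). Qed.

Lemma mkseq_cylinder (s : seq X) (w : nat -> X) (n : nat) :
  cylinder s w -> (size s < n)%N ->
  exists r, mkseq w n = s ++ w (size s) :: r.
Proof.
move=> sw sn; exists (map w (iota (size s).+1 (n - (size s).+1))).
by rewrite -{1}(subnKC sn) addSnnS /mkseq iotaD map_cat -/(mkseq _ _) sw.
Qed.

Lemma cylinder_rcons (s : seq X) (x : X) (w : nat -> X) :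
  cylinder (rcons s x) w -> cylinder s w /\ w (size s) = x.
Proof. by rewrite /cylinder /= size_rcons mkseqS => /rcons_inj[]. Qed.

Lemma cylinder_rcons_head (s : seq X) (w : nat -> X) :
  cylinder s w -> cylinder (rcons s (w (size s))) w.
Proof. by rewrite /cylinder /= size_rcons mkseqS => ->. Qed.

Lemma path_of_choice (step : seq X -> X) (s : seq X) :
  exists w : nat -> X, cylinder s w /\
    forall n, mkseq w (size s + n).+1 =
      rcons (mkseq w (size s + n)) (step (mkseq w (size s + n))).
Proof.
pose u n := iter n (fun t => rcons t (step t)) s.
(* [u k.+1] has length [size s + k.+1], so index [k] is in range even for empty [s] and the default
   is never read. *)
pose w k := nth (step s) (u k.+1) k.
have sizeu n : size (u n) = (size s + n)%N.
  by elim: n => [|n IH]; rewrite ?addn0//= size_rcons IH addnS.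
have nthu m n k : (k < size (u n))%N ->
    nth (step s) (u (m + n)%N) k = nth (step s) (u n) k.
  elim: m => // m IH kn; rewrite addSn /= nth_rcons sizeu.
  by rewrite ifT ?IH// (leq_trans kn)// sizeu leq_add2l leq_addl.
have wu n : mkseq w (size s + n) = u n.
  apply: (@eq_from_nth _ (step s)); rewrite size_mkseq ?sizeu// => k kn.
  (* Neither of [u k.+1] and [u n] need be the longer one, so both are compared with [u (n + k.+1)],
     which extends them. *)
  rewrite nth_mkseq// /w -(nthu n k.+1) ?sizeu ?addnS ?ltnS ?leq_addl//.
  by rewrite -[(n + k).+1]addSn addnC -addSnnS nthu ?sizeu.
exists w; split; first by have := wu 0%N; rewrite addn0.
by move=> n; rewrite -addnS !wu.
Qed.

Lemma supermartingale_liminf_lb (M : seq X -> \bar R) (s : seq X)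
    (c : \bar R) (x0 : X) :
  supermartingale Q M -> bounded_below M ->
  (forall w, cylinder s w -> c <= path_liminf M w) -> c <= M s.
Proof.
move=> sM bM cM.
pose step t := [arg min_(x < x0) M (rcons t x)]%O.
have stepM t : M (rcons t (step t)) <= M t.
  apply: le_trans (sM t); rewrite /step.
  case: Order.TotalTheory.arg_minP => // x _ xmin.
  (* The least value over the children, seen as a constant map, lies below [M (rcons t _)], and
     [Q t] fixes this constant. *)
  rewrite -[leLHS](ue_ecst (hQ t)); last exact: bounded_below_neqNy.
  apply: (ue_monotone (hQ t)) => [||y]; last exact: xmin.
    exact/bounded_below_cst/bounded_below_neqNy.
  by case: bM => b bM; exists b.
have [w [sw wstep]] := path_of_choice step s.
apply: (le_trans (cM _ sw)); rewrite -[leRHS]limn_einf_cst.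
apply: (@le_limn_einf_near _ _ _ (size s)) => n /subnKC <-.
elim: (n - size s)%N => [|k IH]; first by rewrite addn0 sw.
by rewrite addnS wstep (le_trans (stepM _)).
Qed.

(** [N x] is read at the whole string [t], not at the part after [s], so it can be a supermartingale
    of the original tree. The value [+oo] makes the local inequality trivial at situations not
    extending [s], proper prefixes of [s] included. *)
Definition paste (s : seq X) (a : \bar R) (N : X -> seq X -> \bar R)
    (t : seq X) : \bar R :=
  if prefix s t then if drop (size s) t is x :: _ then N x t else a else +oo.

Lemma paste_cat (s u : seq X) (a : \bar R) (N : X -> seq X -> \bar R) :
  paste s a N (s ++ u) = if u is x :: _ then N x (s ++ u) else a.
Proof. by rewrite /paste prefix_prefix drop_size_cat. Qed.

Lemma paste_root (s : seq X) (a : \bar R) (N : X -> seq X -> \bar R) :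
  paste s a N s = a.
Proof. by rewrite -{2}[s]cats0 paste_cat. Qed.

Lemma supermartingale_paste (s : seq X) (a : \bar R) (N : X -> seq X -> \bar R) :
  (forall x, supermartingale Q (N x)) -> Q s (fun x => N x (rcons s x)) <= a ->
  supermartingale Q (paste s a N).
Proof.
move=> sN Na t; have [/prefixP[[|x u] ->]|/negPf st] := boolP (prefix s t).
- rewrite cats0 paste_root; apply: le_trans Na.
  by under eq_fun do rewrite -cats1 paste_cat cats1.
- rewrite paste_cat; congr (Q _ _ <= _): (sN x (s ++ x :: u)).
  by apply/funext => y; rewrite rcons_cat paste_cat.
- by rewrite [leRHS]/paste st leey.
Qed.

Lemma bounded_below_paste (s : seq X) (a : \bar R) (N : X -> seq X -> \bar R) :
  (forall x, bounded_below (N x)) -> a != -oo -> bounded_below (paste s a N).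
Proof.
move=> /finite_uniform_bounded_below[c cN] aNy.
have [b /(_ tt) ba] := @bounded_below_cst R unit a aNy.
exists (Order.min b c) => t; rewrite /paste EFin_min ge_min.
case: ifP => _; last by rewrite leey.
by case: (drop _ _) => [|x r]; rewrite ?ba ?cN ?orbT.
Qed.

(** Along [w] both processes agree at all lengths above [size s], and the limit inferior depends
    only on such a tail. *)
Lemma path_liminf_paste (s : seq X) (a : \bar R) (N : X -> seq X -> \bar R)
    (w : nat -> X) :
  cylinder s w -> path_liminf (N (w (size s))) w <= path_liminf (paste s a N) w.
Proof.
move=> sw; apply: (@le_limn_einf_near _ _ _ (size s).+1) => n sn.
by have [r ->] := mkseq_cylinder sw sn; rewrite paste_cat.
Qed.

(** Both inequalities of the theorem end here: the pasted process is admissible for [g] at [s] and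
    has value [a] there. *)
Lemma game_upper_expectation_le_paste (g : (nat -> X) -> \bar R) (s : seq X)
    (a : \bar R) (N : X -> seq X -> \bar R) :
  (forall x, supermartingale Q (N x)) -> (forall x, bounded_below (N x)) ->
  (forall w, cylinder s w -> g w <= path_liminf (N (w (size s))) w) ->
  a != -oo -> Q s (fun x => N x (rcons s x)) <= a ->
  game_upper_expectation Q g s <= a.
Proof.
move=> sN bN gN aNy Na; apply: ge_ereal_inf; exists a => //.
exists (paste s a N); last exact: paste_root.
split; [exact: supermartingale_paste|exact: bounded_below_paste|].
by move=> w sw; exact: le_trans (gN w sw) (path_liminf_paste _ _ sw).
Qed.

(** The bound [b] replaces the infimum, which may be [-oo] and then leaves no room for adding [e].
    If [b] is [+oo], the constant [+oo] serves. *)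
Lemma game_upper_expectation_approx (f : (nat -> X) -> \bar R) (s : seq X)
    (b : \bar R) (e : R) :
  (0 < e)%R -> b != -oo -> game_upper_expectation Q f s <= b ->
  exists M : seq X -> \bar R,
    [/\ supermartingale Q M, bounded_below M,
        (forall w, cylinder s w -> f w <= path_liminf M w) &
        M s <= b + e%:E].
Proof.
case: b => [b||]// e0 _ fb.
- have /ereal_inf_lt[_ [M [sM bM fM] <-] Ms] :
      game_upper_expectation Q f s < b%:E + e%:E.
    by rewrite (le_lt_trans fb)// lteDl// lte_fin.
  by exists M; split => //; exact: ltW.
- exists (fun=> +oo); split; [exact: supermartingale_cst|exact: bounded_below_cst| |] => //.
  by move=> w _; rewrite /path_liminf limn_einf_cst leey.
Qed.

End supermartingales.

Theorem theorem15 (R : realType) (X : finType) (hX : (0 < #|X|)%N)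
    (Q : seq X -> (X -> \bar R) -> \bar R)
    (hQ : forall s : seq X, upper_expectation (Q s))
    (f : (nat -> X) -> \bar R) (s : seq X) :
  game_upper_expectation Q f s =
  game_upper_expectation Q
    (fun w : nat -> X => game_upper_expectation Q f (rcons s (w (size s)))) s.
Proof.
apply/eqP; rewrite eq_le; apply/andP; split.
- apply: le_ereal_inf_tmp => _ [M [sM bM gM] <-].
  have fM x : game_upper_expectation Q f (rcons s x) <= M (rcons s x).
    (* On this cylinder the inner conditional expectation is constant; [x] itself shows that [X] is
       inhabited. *)
    apply: (supermartingale_liminf_lb hQ x sM bM) => w /cylinder_rcons[sw wx].
    by have := gM w sw; rewrite wx.
  apply/lee_addgt0Pr => e e0.
  have /choice[N NP] := fun x => game_upper_expectation_approx hQ e0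
    (bounded_below_neqNy (rcons s x) bM) (fM x).
  have [b bMb] := bM.
  have sN x : supermartingale Q (N x) by have [] := NP x.
  have bN x : bounded_below (N x) by have [] := NP x.
  apply: (game_upper_expectation_le_paste sN bN).
  + by move=> w sw; have [_ _ + _] := NP (w (size s)); apply; exact: cylinder_rcons_head.
  + by rewrite adde_eq_ninfty negb_or bounded_below_neqNy.
  + have bMs : bounded_below (fun x => M (rcons s x)) by exists b.
    (* The pasted root value is [M s + e%:E]: the error [e], common to all children, passes through
       [Q s]. *)
    apply: le_trans (leeD2r _ (sM s)); apply: le_trans (ue_shift_le (hQ s) e bMs).
    apply: (ue_monotone (hQ s)) => [||x]; last by have [] := NP x.
    * by have [c cN] := finite_uniform_bounded_below bN; exists c.
    * by exists (b + e)%R => x; rewrite EFinD leeD2r.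
- apply: le_ereal_inf_tmp => _ [M [sM bM fM] <-].
  apply: (@game_upper_expectation_le_paste _ _ _ _ s _
    (fun x _ => M (rcons s x))).
  + by move=> x; apply: (supermartingale_cst hQ); exact: bounded_below_neqNy.
  + by move=> x; apply/bounded_below_cst/bounded_below_neqNy.
  + move=> w sw; rewrite /path_liminf limn_einf_cst.
    (* [M] itself competes in the infimum at the child, whose cylinder lies inside that of [s]. *)
    apply: ge_ereal_inf; exists (M (rcons s (w (size s)))) => //.
    by exists M => //; split => // v /cylinder_rcons[/fM].
  + exact: bounded_below_neqNy.
  + exact: sM.
Qed.
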